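(* Let $M$ be an incomplete matrix over a field $\mathbb{F}$, let $n\ge 1$, and let $B_1,\dots,B_n$ be incomplete matrices over $\mathbb{F}$ such that $M\sim \mathrm{u\text{-}diag}(B_1,\dots,B_n)$. Then $$mr(M)=\max_{1\le i\le n} mr(B_i).$$
   Context: Let $\mathbb{F}$ be an arbitrary field. An incomplete matrix over $\mathbb{F}$ is a finite-size matrix each of whose entries is either a known element of $\mathbb{F}$ or unknown (written $?$); all or none of the entries may be unknown. A completion of $M$ is a matrix over $\mathbb{F}$ of the same size that agrees with $M$ at all known entries; $S(M)$ is the set of completions of $M$, and $mr(M)=\min_{\bar M\in S(M)}\mathrm{rank}\,\bar M$. A row (column) of an incomplete matrix is a junk row (column) if each of its entries is either the known value $0$ or unknown. Write $M\sim N$ if $N$ can be obtained from $M$ through a finite sequence of operations of the following kinds: interchanging rows, interchanging columns, deleting a junk row or junk column, and adjoining a junk row or junk column. $\mathrm{u\text{-}diag}(B_1,\dots,B_n)$ denotes the block matrix whose diagonal blocks are the incomplete matrices $B_1,\dots,B_n$ (not necessarily square), in that order, and all of whose off-diagonal blocks consist entirely of unknown entries. *)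

(* Defs.v *)
From mathcomp Require Import all_boot all_order all_algebra.
From mathcomp Require Import boolp.

Set Implicit Arguments.
Unset Strict Implicit.
Unset Printing Implicit Defensive.

Import GRing.Theory.

Local Open Scope ring_scope.

Section IncompleteMatrix.

Variable F : fieldType.

(* An incomplete m x n matrix has type 'M[option F]_(m, n): the entry Some a is
   the known value a, and None is an unknown entry. Sizes may be 0. *)

Definition completion m n (M : 'M[option F]_(m, n)) (N : 'M[F]_(m, n)) : Prop :=
  forall i j a, M i j = Some a -> N i j = a.

Definition completion_rank m n (M : 'M[option F]_(m, n)) : pred nat :=
  fun r => `[< exists2 N : 'M[F]_(m, n), completion M N & \rank N = r >].

Lemma ex_completion_rank m n (M : 'M[option F]_(m, n)) :
  exists r, completion_rank M r.
Proof.
exists (\rank (map_mx (odflt 0) M)); apply/asboolP.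
by exists (map_mx (odflt 0) M) => // i j a Mij; rewrite mxE Mij.
Qed.

Definition mr m n (M : 'M[option F]_(m, n)) : nat :=
  ex_minn (ex_completion_rank M).

Definition junk_row m n (M : 'M[option F]_(m, n)) (i : 'I_m) : Prop :=
  forall j, M i j = Some 0 \/ M i j = None.

Definition junk_col m n (M : 'M[option F]_(m, n)) (j : 'I_n) : Prop :=
  forall i, M i j = Some 0 \/ M i j = None.

(* Adjoining a junk row (column), at an arbitrary position, is the converse of
   deleting one. *)
Inductive sim_step :
  forall m n p q, 'M[option F]_(m, n) -> 'M[option F]_(p, q) -> Prop :=
| sim_step_xrow m n (M : 'M[option F]_(m, n)) i1 i2 :
    sim_step M (xrow i1 i2 M)
| sim_step_xcol m n (M : 'M[option F]_(m, n)) j1 j2 :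
    sim_step M (xcol j1 j2 M)
| sim_step_delete_row m n (M : 'M[option F]_(m, n)) i :
    junk_row M i -> sim_step M (row' i M)
| sim_step_delete_col m n (M : 'M[option F]_(m, n)) j :
    junk_col M j -> sim_step M (col' j M)
| sim_step_adjoin_row m n (M : 'M[option F]_(m, n)) i :
    junk_row M i -> sim_step (row' i M) M
| sim_step_adjoin_col m n (M : 'M[option F]_(m, n)) j :
    junk_col M j -> sim_step (col' j M) M.

Inductive sim :
  forall m n p q, 'M[option F]_(m, n) -> 'M[option F]_(p, q) -> Prop :=
| sim_refl m n (M : 'M[option F]_(m, n)) : sim M M
| sim_cons m n p q s t (M : 'M[option F]_(m, n)) (N : 'M[option F]_(p, q))
    (P : 'M[option F]_(s, t)) :
    sim_step M N -> sim N P -> sim M P.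

(* As in mxdiag, conform_mx only casts B i from 'M_(p_ i, q_ i) to
   'M_(p_ i, q_ j) when i = j; its default value is never used. *)
Definition udiag n (p_ q_ : 'I_n -> nat)
    (B : forall i, 'M[option F]_(p_ i, q_ i)) :
    'M[option F]_(\sum_i p_ i, \sum_j q_ j) :=
  \mxblock_(i, j) (if i == j then conform_mx (const_mx None) (B i)
                   else const_mx None).

End IncompleteMatrix.

(* Main.v *)
Require Import Defs.
From mathcomp Require Import all_boot all_order all_algebra.
From mathcomp Require Import perm boolp.

(** A matrix has rank at most r iff it factors through dimension r.  Optimal
    completions of the B_i, padded to the common inner dimension
    r = max_i mr(B_i) as U_i V_i, glue to the completion (U_i V_j)_(i,j) of the
    block matrix, whose unknown off-diagonal entries impose no constraint.  In
    the other direction mr decreases on submatrices, and a junk row or column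
    can be completed by zeros. *)

Set Implicit Arguments.
Unset Strict Implicit.
Unset Printing Implicit Defensive.

Import GRing.Theory.

Local Open Scope ring_scope.

Lemma rank_factorP (F : fieldType) m n r (N : 'M[F]_(m, n)) :
  reflect (exists (U : 'M[F]_(m, r)) (V : 'M[F]_(r, n)), N = U *m V)
          (\rank N <= r)%N.
Proof.
apply: (iffP idP) => [rN | [U [V ->]]]; last first.
  exact: leq_trans (mxrankM_maxl U V) (rank_leq_col U).
(* The two [pid_mx] split the middle factor of [mulmx_ebase] through dimension [r], padding with
   zeros when [r] exceeds the rank. *)
exists (col_ebase N *m pid_mx (\rank N)), (pid_mx (\rank N) *m row_ebase N).
by rewrite -mulmxA (mulmxA (pid_mx _)) pid_mx_id // mulmxA mulmx_ebase.
Qed.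

Section MinimumRank.

Variable F : fieldType.
Implicit Types m n p q r : nat.

(** Turns bounds on [mr] into constructions on factors. As [r] may exceed the minimum, several
    matrices can share one inner dimension. *)
Lemma mr_leP m n (M : 'M[option F]_(m, n)) r :
  reflect (exists (U : 'M[F]_(m, r)) (V : 'M[F]_(r, n)), completion M (U *m V))
          (mr M <= r)%N.
Proof.
rewrite /mr; case: ex_minnP => s Ms s_min.
apply: (iffP idP) => [le_sr | [U [V MUV]]].
  have /asboolP [N MN Ns] := Ms.
  have /rank_factorP [U [V NUV]] : (\rank N <= r)%N by rewrite Ns.
  by exists U, V; rewrite -NUV.
have/s_min /leq_trans : completion_rank M (\rank (U *m V)).
  by apply/asboolP; exists (U *m V).
by apply; apply/rank_factorP; exists U, V.
Qed.

(** Reindex the rows of [U] by [f] and the columns of [V] by [g]. Since [f] and [g] are arbitrary,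
    this covers swaps, deletions and extraction of blocks. *)
Lemma mr_mxsub m n p q (M : 'M[option F]_(m, n)) (f : 'I_p -> 'I_m)
    (g : 'I_q -> 'I_n) : (mr (mxsub f g M) <= mr M)%N.
Proof.
have /mr_leP [U [V MUV]] := leqnn (mr M).
apply/mr_leP; exists (rowsub f U), (colsub g V) => i j a.
by rewrite -mxsub_mul !mxE => /MUV; rewrite mxE.
Qed.

Lemma mr_xrow m n (M : 'M[option F]_(m, n)) i1 i2 : mr (xrow i1 i2 M) = mr M.
Proof.
have le_xrow (A : 'M[option F]_(m, n)) : (mr (xrow i1 i2 A) <= mr A)%N.
  suff -> : xrow i1 i2 A = mxsub (tperm i1 i2) id A by exact: mr_mxsub.
  by apply/matrixP => i j; rewrite !mxE.
apply/eqP; rewrite eqn_leq le_xrow /=.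
suff {1}-> : M = xrow i1 i2 (xrow i1 i2 M) by exact: le_xrow.
by apply/matrixP => i j; rewrite !mxE tpermK.
Qed.

Lemma mr_row' m n (M : 'M[option F]_(m, n)) i :
  junk_row M i -> mr (row' i M) = mr M.
Proof.
move=> junk; apply/eqP; rewrite eqn_leq; apply/andP; split.
  suff -> : row' i M = mxsub (lift i) id M by exact: mr_mxsub.
  by apply/matrixP => x y; rewrite !mxE.
have /mr_leP [U [V MUV]] := leqnn (mr (row' i M)).
(* A zero row is inserted into [U] at position [i], so row [i] of the product vanishes, as the junk
   row allows. *)
apply/mr_leP; exists (\matrix_(x, y) oapp (U^~ y) 0 (unlift i x)), V => x y a.
rewrite mxE; case: (unliftP i x) => [x' | ] -> Mxy.
  have <- : (U *m V) x' y = a by apply: MUV; rewrite mxE.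
  by rewrite mxE; apply: eq_bigr => z _; rewrite mxE liftK.
have -> : a = 0 by case: (junk y); rewrite Mxy // => -[].
by apply: big1 => z _; rewrite mxE unlift_none mul0r.
Qed.

(** Carries the row results over to columns. *)
Lemma mr_trmx m n (M : 'M[option F]_(m, n)) : mr M^T = mr M.
Proof.
have le_tr p q (A : 'M[option F]_(p, q)) : (mr A^T <= mr A)%N.
  have /mr_leP [U [V AUV]] := leqnn (mr A).
  apply/mr_leP; exists V^T, U^T => i j a.
  by rewrite -trmx_mul !mxE => /AUV; rewrite mxE.
by apply/eqP; rewrite eqn_leq le_tr -{1}[M]trmxK le_tr.
Qed.

Lemma mr_xcol m n (M : 'M[option F]_(m, n)) j1 j2 : mr (xcol j1 j2 M) = mr M.
Proof. by rewrite -mr_trmx tr_xcol mr_xrow mr_trmx. Qed.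

Lemma mr_col' m n (M : 'M[option F]_(m, n)) j :
  junk_col M j -> mr (col' j M) = mr M.
Proof.
move=> junk; rewrite -mr_trmx tr_col' mr_row' ?mr_trmx // => i.
by rewrite mxE.
Qed.

Lemma mr_sim m n p q (M : 'M[option F]_(m, n)) (N : 'M[option F]_(p, q)) :
  sim M N -> mr M = mr N.
Proof.
elim=> {m n p q M N} // m n p q s t M N P MN _ <-.
case: MN => {m n p q s t M N P} m n M.
- by move=> i1 i2; rewrite mr_xrow.
- by move=> j1 j2; rewrite mr_xcol.
- by move=> i /mr_row' ->.
- by move=> j /mr_col' ->.
- by move=> i /mr_row' ->.
- by move=> j /mr_col' ->.
Qed.

Lemma mr_udiag n (p_ q_ : 'I_n -> nat)
    (B : forall i, 'M[option F]_(p_ i, q_ i)) :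
  mr (udiag B) = (\max_(i < n) mr (B i))%N.
Proof.
apply/eqP; rewrite eqn_leq; apply/andP; split; last first.
  apply/bigmax_leqP => i _.
  suff {1}-> : B i = submxblock (udiag B) i i by exact: mr_mxsub.
  by rewrite mxblockK eqxx conform_mx_id.
set r := (\max_(i < n) mr (B i))%N.
(* Stated as a sigma type, by choice, so that the factors become functions of [i] that can be
   stacked. *)
have UV i : {U & {V : 'M[F]_(r, q_ i) | completion (B i) (U *m V)}}.
  have /mr_leP /cid [U /cid UV] : (mr (B i) <= r)%N by rewrite leq_bigmax.
  by exists U.
pose U i := projT1 (UV i); pose V i := sval (projT2 (UV i)).
have BUV i : completion (B i) (U i *m V i) := svalP (projT2 (UV i)).
apply/mr_leP; exists (\mxcol_i U i), (\mxrow_j V j).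
rewrite mul_mxcol_mxrow => x y a; rewrite !mxE.
case: eqP => [e | _]; last by rewrite mxE.
(* The type of the inner column index depends on the block of [y]; generalizing it lets [e] identify
   the two blocks and remove the cast. *)
move: (tagnat.sig2 y); rewrite -e => y'; rewrite conform_mx_id => /BUV.
by rewrite mxE.
Qed.

End MinimumRank.

Theorem theorem3p1 (F : fieldType) (k l : nat) (M : 'M[option F]_(k, l))
    (n : nat) (n_ge1 : (1 <= n)%N) (p_ q_ : 'I_n -> nat)
    (B : forall i : 'I_n, 'M[option F]_(p_ i, q_ i)) :
  sim M (udiag B) -> mr M = (\max_(i < n) mr (B i))%N.
Proof. by move=> /mr_sim ->; rewrite mr_udiag. Qed.
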